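(* Let $k$ be a field, $R=k[x_1,\dots,x_n]$, and let $I\subseteq R$ be the edge ideal of a hypergraph $\mathcal H$ on the vertex set $V=\{1,\dots,n\}$. Let $\mathbf a=(a_1,\dots,a_n)\in\mathbb N^n$ (entries $\ge 0$) and $U=\{i\mid a_i\neq 0\}$. Then $x^{\mathbf a}\in\widetilde{I^2}\setminus I^2$ if and only if $\mathbf a\in\{0,1\}^n$ and $U$ is a 2-saturating set of $\mathcal H$.
   Context: A hypergraph $\mathcal H$ on $V=\{1,\dots,n\}$ is a set of subsets of $V$ (its edges); containments between edges are allowed. For $F\subseteq V$ put $x^F=\prod_{i\in F}x_i$, and $x^{\mathbf a}=x_1^{a_1}\cdots x_n^{a_n}$. The edge ideal of $\mathcal H$ is the ideal of $R$ generated by all $x^F$, $F\in\mathcal H$. For a homogeneous ideal $J\subseteq R$, its saturation is $\widetilde J=\bigcup_{t\ge1}(J:\mathfrak m^t)$ with $\mathfrak m=(x_1,\dots,x_n)$. A set $U\subseteq V$ is decomposable in a hypergraph if $U$ can be partitioned into two (possibly empty) disjoint subsets each of which contains an edge of the hypergraph; otherwise $U$ is indecomposable. (So every $U$ is decomposable if $\emptyset$ is an edge.) For $i\in V$ set $\mathcal H(i)=\{F\setminus\{i\}\mid F\in\mathcal H\}$. A set $U\subseteq V$ is a 2-saturating set of $\mathcal H$ if $U$ is indecomposable in $\mathcal H$ and, for every $i\in V$, $U\setminus\{i\}$ is decomposable in $\mathcal H(i)$. *)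

(* Defs.v *)
From HB Require Import structures.
From mathcomp Require Import all_boot all_order all_algebra.
From mathcomp Require Import mpoly.

Set Implicit Arguments.
Unset Strict Implicit.
Unset Printing Implicit Defensive.

Import GRing.Theory.
Local Open Scope ring_scope.

(* Ideals are Prop-valued predicates, since the `idealr` structure of
   ring_quotient only covers decidable proper ideals. *)
Section Ideals.
Variable R : comNzRingType.
Implicit Types I J G : R -> Prop.

Definition ideal_gen G : R -> Prop := fun f =>
  exists (m : nat) (c g : 'I_m -> R),
    (forall j, G (g j)) /\ f = \sum_(j < m) c j * g j.

Definition ideal_mul I J : R -> Prop :=
  ideal_gen (fun h => exists f g, [/\ I f, J g & h = f * g]).

Definition ideal_exp I (t : nat) : R -> Prop :=
  iter t (ideal_mul I) (fun=> True).

Definition ideal_colon I J : R -> Prop := fun f => forall g, J g -> I (f * g).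

End Ideals.

Section Polynomials.
Variables (n : nat) (k : fieldType).

Definition irrelevant_ideal : {mpoly k[n]} -> Prop :=
  ideal_gen (fun f => exists i : 'I_n, f = 'X_i).

Definition saturation (J : {mpoly k[n]} -> Prop) : {mpoly k[n]} -> Prop :=
  fun f => exists2 t : nat,
    (1 <= t)%N & ideal_colon J (ideal_exp irrelevant_ideal t) f.

Definition edge_ideal (H : {set {set 'I_n}}) : {mpoly k[n]} -> Prop :=
  ideal_gen (fun f => exists2 F, F \in H & f = \prod_(i in F) 'X_i).

End Polynomials.

Arguments edge_ideal {n} k H.

Section Hypergraphs.
Variable T : finType.
Implicit Types (H : {set {set T}}) (U : {set T}).

Definition contains_edge H U : Prop := exists2 F, F \in H & F \subset U.

(* The parts A and B may be empty, so this is not finset's `partition`. *)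
Definition decomposable H U : Prop :=
  exists A B : {set T}, [/\ A :|: B = U, [disjoint A & B],
    contains_edge H A & contains_edge H B].

Definition edges_minus H (i : T) : {set {set T}} := [set F :\ i | F in H].

Definition two_saturating H U : Prop :=
  ~ decomposable H U /\
  forall i : T, decomposable (edges_minus H i) (U :\ i).

End Hypergraphs.

(* Main.v *)
(* x^a lies in I^2 iff two edges F, G (possibly equal) satisfy 1_F + 1_G <= a,
   and in the saturation iff for every i this holds once a_i is made large.
   Since (1_F + 1_G)_i <= 2, enlarging a_i changes nothing when a_i >= 2; so
   if x^a lies in the saturation but not in I^2, then a is a 0/1 vector, and
   F \ {i}, G \ {i} decompose U \ {i}. Conversely x_i^2 x^a lies in I^2 for all
   i, and every monomial of degree n + 1 is divisible by some x_i^2. *)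
Require Import Defs.
From HB Require Import structures.
From mathcomp Require Import all_boot all_order all_algebra.
From mathcomp Require Import mpoly.

Set Implicit Arguments.
Unset Strict Implicit.
Unset Printing Implicit Defensive.

Import GRing.Theory.
Local Open Scope ring_scope.

(** * Closure properties of generated ideals, their products and powers *)

Section IdealGen.
Variable R : comNzRingType.
Implicit Types (I J G : R -> Prop) (f g : R).

Lemma ideal_gen_gen G f : G f -> ideal_gen G f.
Proof.
move=> Gf; exists 1%N, (fun=> 1), (fun=> f); split=> //.
by rewrite big_ord1 mul1r.
Qed.

Lemma ideal_gen0 G : ideal_gen G 0.
Proof.
exists 0%N, (fun=> 0), (fun=> 0); split; first by case.
by rewrite big_ord0.
Qed.

Lemma ideal_genD G f g : ideal_gen G f -> ideal_gen G g -> ideal_gen G (f + g).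
Proof.
move=> [m [c [u [Gu ->]]]] [p [d [v [Gv ->]]]].
exists (m + p)%N, (fun j => match split j with inl i => c i | inr i => d i end),
  (fun j => match split j with inl i => u i | inr i => v i end).
split=> [j|]; first by case: (split j).
have splitl i : split (lshift p i) = inl i := unsplitK (inl i).
have splitr i : split (rshift m i) = inr i := unsplitK (inr i).
by rewrite big_split_ord /=; congr (_ + _); apply: eq_bigr => i _;
  rewrite ?splitl ?splitr.
Qed.

Lemma ideal_genMl G f g : ideal_gen G g -> ideal_gen G (f * g).
Proof.
move=> [m [c [u [Gu ->]]]]; exists m, (fun j => f * c j), u; split=> //.
by rewrite mulr_sumr; apply: eq_bigr => j _; rewrite mulrA.
Qed.

Lemma ideal_gen_sum G (T : eqType) (r : seq T) (F : T -> R) :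
  {in r, forall x, ideal_gen G (F x)} -> ideal_gen G (\sum_(x <- r) F x).
Proof.
move=> GF; rewrite big_seq.
by apply: big_ind => //; [exact: ideal_gen0 | exact: ideal_genD].
Qed.

Lemma ideal_mulM I J f g : I f -> J g -> ideal_mul I J (f * g).
Proof. by move=> If Jg; apply: ideal_gen_gen; exists f, g. Qed.

Lemma ideal_exp_expr I f t : I f -> ideal_exp I t (f ^+ t).
Proof.
move=> If; elim: t => [//|t IHt].
by rewrite exprS; apply: ideal_mulM.
Qed.

End IdealGen.

(** * Exponent vectors occurring in members of an ideal *)

Section Support.
Variables (n : nat) (k : fieldType).
Implicit Types (m : 'X_{1..n}) (f g : {mpoly k[n]}) (G I J : {mpoly k[n]} -> Prop).

(** A monomial of a sum of terms [c j * g j] is a monomial of some [c j] times one of [g j], so an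
    upward closed condition on exponents passes from the generators to the whole ideal. *)
Lemma ideal_gen_msupp G (P : 'X_{1..n} -> Prop) f :
    (forall m1 m2, P m2 -> P (m1 + m2)%MM) ->
    (forall g, G g -> {in msupp g, forall m, P m}) ->
  ideal_gen G f -> {in msupp f, forall m, P m}.
Proof.
move=> Pup GP [p [c [g [Gg ->]]]] m /msupp_sum_le /flattenP [s].
case/mapP=> j _ -> /msuppM_le /allpairsP [[m1 m2] /= [_ m2g ->]].
exact/Pup/(GP _ (Gg j)).
Qed.

Lemma ideal_mul_msupp I J (P Q S : 'X_{1..n} -> Prop) f :
    (forall m1 m2, S m2 -> S (m1 + m2)%MM) ->
    (forall m1 m2, P m1 -> Q m2 -> S (m1 + m2)%MM) ->
    (forall g, I g -> {in msupp g, forall m, P m}) ->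
    (forall g, J g -> {in msupp g, forall m, Q m}) ->
  ideal_mul I J f -> {in msupp f, forall m, S m}.
Proof.
move=> Sup SPQ IP JQ; apply: ideal_gen_msupp => // _ [g [h [Ig Jh ->]]] m.
move=> /msuppM_le /allpairsP [[m1 m2] /= [m1g m2h ->]].
by apply: SPQ; [apply: IP m1g | apply: JQ m2h].
Qed.

(** Each of the [t] factors adds at least 1 to the degree. This bound stands in for a list of
    generators of the power. *)
Lemma irrelevant_exp_msupp t f :
  ideal_exp (@irrelevant_ideal n k) t f ->
  {in msupp f, forall m, (t <= mdeg m)%N}.
Proof.
elim: t f => [//|t IHt] f /=.
apply: (@ideal_mul_msupp _ _ (fun m => 1 <= mdeg m)%N (fun m => t <= mdeg m)%N
  (fun m => t < mdeg m)%N) => // [m1 m2|m1 m2|g].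
- by rewrite mdegD => /leq_trans; apply; rewrite leq_addl.
- by rewrite mdegD -add1n; apply: leq_add.
apply: (@ideal_gen_msupp _ (fun m => 1 <= mdeg m)%N) => [m1 m2|_ [i ->] m].
- by rewrite mdegD => /leq_trans; apply; rewrite leq_addl.
by rewrite msuppX inE => /eqP ->; rewrite mdeg1.
Qed.

(** Pigeonhole: [n] entries that are all at most 1 sum to at most [n]. *)
Lemma mdeg_gt_exists2 m : (n < mdeg m)%N -> exists i, (2 <= m i)%N.
Proof.
move=> lt_nm; apply/existsP; apply: contraLR lt_nm => /existsPn m_le1.
rewrite -leqNgt mdegE -[leqRHS]card_ord -sum1_card.
by apply: leq_sum => i _; rewrite leqNgt m_le1.
Qed.

End Support.

(** As the right side is at most 1, the inequality says that [F] and [G] are disjoint and lie in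
    [U]. Then [F] and [U :\: F] form the partition, and [G] fits into the second part. *)
Lemma decomposableP (T : finType) (H : {set {set T}}) (U : {set T}) :
  decomposable H U <->
  exists F G, [/\ F \in H, G \in H & forall x, (x \in F) + (x \in G) <= (x \in U)]%N.
Proof.
split=> [[A [B [<- disjAB [F HF FA] [G HG GB]]]]|[F [G [HF HG leFG]]]].
  exists F, G; split=> // x; rewrite inE.
  have /implyP := subsetP FA x; have /implyP := subsetP GB x.
  have := @disjointFr _ _ _ x disjAB.
  case: (x \in A) => [->//|_]; last by case: (x \in F) (x \in G) (x \in B) => [] [] [].
  by case: (x \in F) (x \in G) => [] [].
exists F, (U :\: F); split.
- apply/setP => x; have := leFG x; rewrite !inE.
  by case: (x \in F) (x \in G) (x \in U) => [] [] [].
- by rewrite disjoint_sym disjoints_subset setDE subsetIr.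
- by exists F.
exists G => //; apply/subsetP => x; have := leFG x; rewrite inE.
by case: (x \in F) (x \in G) (x \in U) => [] [] [].
Qed.

(** * Monomials in the square of an edge ideal and in its saturation *)

Section EdgeIdealSquare.
Variables (n : nat) (H : {set {set 'I_n}}).
Implicit Types (F G : {set 'I_n}) (m : 'X_{1..n}).

(** Divisibility of x^m by x^F x^G, written on exponents; it has the same shape as the criterion in
    [decomposableP]. *)
Definition has_two_edges m : Prop :=
  exists F G, [/\ F \in H, G \in H &
    forall i, ((i \in F) + (i \in G) <= m i)%N].

Lemma has_two_edges_addl m1 m2 :
  has_two_edges m2 -> has_two_edges (m1 + m2)%MM.
Proof.
move=> [F [G [HF HG le_m]]]; exists F, G; split=> // i.
by rewrite mnmDE (leq_trans (le_m i)) ?leq_addl.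
Qed.

(** [mesym1 F] is the indicator vector of [F]. *)
Lemma edge_monomialE (k : fieldType) F :
  \prod_(i in F) 'X_i = 'X_[k, mesym1 F].
Proof.
rewrite mprodXE; congr 'X_[_]; apply/mnmP => j.
rewrite mnm_sumE mnmE; under eq_bigr do rewrite mnm1E.
have [jF|jF] := boolP (j \in F).
  by rewrite (bigD1 j) //= eqxx big1 // => i /andP [_ /negPf ->].
by rewrite big1 // => i iF; case: eqP => // eij; rewrite -eij iF in jF.
Qed.

Lemma edge_ideal_sqr_msupp (k : fieldType) (f : {mpoly k[n]}) :
  ideal_exp (edge_ideal k H) 2 f -> {in msupp f, forall m, has_two_edges m}.
Proof.
pose P m := exists2 F, F \in H & forall i, ((i \in F) <= m i)%N.
have Pup m1 m2 : P m2 -> P (m1 + m2)%MM.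
  move=> [F HF le_m]; exists F => // i.
  by rewrite mnmDE (leq_trans (le_m i)) ?leq_addl.
have edgeP g : edge_ideal k H g -> {in msupp g, forall m, P m}.
  apply: ideal_gen_msupp => // _ [F HF ->] m.
  rewrite edge_monomialE msuppX inE => /eqP ->.
  by exists F => // i; rewrite mnmE.
apply: (@ideal_mul_msupp _ _ _ _ P P) => //.
- exact: has_two_edges_addl.
- move=> m1 m2 [F HF leF] [G HG leG]; exists F, G; split=> // i.
  by rewrite mnmDE leq_add.
(* The square unfolds to I * (I * R), so the second factor is again a product, with the trivial
   condition on R. *)
move=> g; apply: (@ideal_mul_msupp _ _ _ _ P (fun=> True)) => // m1 m2.
by rewrite addmC => Pm1 _; apply: Pup.
Qed.

Lemma mem_edge_ideal_sqrX (k : fieldType) m :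
  ideal_exp (edge_ideal k H) 2 'X_[k, m] <-> has_two_edges m.
Proof.
split=> [/edge_ideal_sqr_msupp|[F [G [HF HG le_m]]]].
  by apply; rewrite msuppX inE.
have le_FG : (mesym1 F + mesym1 G <= m)%MM.
  by apply/mnm_lepP => i; rewrite mnmDE !mnmE.
rewrite -(submK le_FG) mpolyXD; apply: ideal_genMl; rewrite mpolyXD.
apply: ideal_mulM; first by apply: ideal_gen_gen; exists F; rewrite ?edge_monomialE.
(* The factor 1 fills the place of R in I * (I * R). *)
rewrite -[X in _ X]mulr1; apply: ideal_mulM => //.
by apply: ideal_gen_gen; exists G; rewrite ?edge_monomialE.
Qed.

(** The test element is x_i^t, which lies in the [t]-th power of the irrelevant ideal. *)
Lemma saturation_edge_ideal_sqrX (k : fieldType) m :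
  saturation (ideal_exp (edge_ideal k H) 2) 'X_[k, m] ->
  forall i, exists t, has_two_edges (m + U_(i) *+ t)%MM.
Proof.
move=> [t _ sat_m] i; exists t.
apply/(mem_edge_ideal_sqrX k); rewrite mpolyXD -mpolyXn.
apply/sat_m/ideal_exp_expr/ideal_gen_gen.
by exists i.
Qed.

Lemma edge_ideal_sqrX_saturation (k : fieldType) m :
  (forall i, has_two_edges (m + U_(i) *+ 2)%MM) ->
  saturation (ideal_exp (edge_ideal k H) 2) 'X_[k, m].
Proof.
move=> two_m; exists n.+1 => // g /irrelevant_exp_msupp deg_g.
rewrite [g]mpolyE mulr_sumr; apply: ideal_gen_sum => b b_g.
rewrite -scalerAr -mul_mpolyC -mpolyXD; apply: ideal_genMl.
apply/mem_edge_ideal_sqrX; have [i b_i] := mdeg_gt_exists2 (deg_g b b_g).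
have le_b : (U_(i) *+ 2 <= b)%MM.
  by apply/mnm_lepP => j; rewrite mulmnE mnm1E; case: eqP => [<-|].
(* Regroup m + b as (b - 2 e_i) + (m + 2 e_i). *)
by rewrite -(submK le_b) addmC -addmA [(_ *+ 2 + m)%MM]addmC; apply: has_two_edges_addl.
Qed.

End EdgeIdealSquare.

Theorem lemma2p1 (k : fieldType) (n : nat) (H : {set {set 'I_n}})
    (a : 'X_{1..n}) :
  let I2 : {mpoly k[n]} -> Prop := ideal_exp (edge_ideal k H) 2%N in
  let U : {set 'I_n} := [set i | a i != 0%N] in
  (saturation I2 'X_[k, a] /\ ~ I2 'X_[k, a]) <->
  ((forall i : 'I_n, a i = 0%N \/ a i = 1%N) /\ two_saturating H U).
Proof.
move=> I2 U; split=> [[/saturation_edge_ideal_sqrX sat_a]|[a01 [indec dec]]].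
  move/mem_edge_ideal_sqrX => a_notin.
  have a_le1 i : (a i <= 1)%N.
    rewrite leqNgt; apply/negP => a_i; apply: a_notin.
    have [t [F [G [HF HG le_a]]]] := sat_a i; exists F, G; split=> // j.
    (* Away from [i] the bound is that of [le_a]; at [i] its left side is at most 2, hence at most
       [a i]. *)
    have [<-|/negPf neq_ij] := eqVneq i j; last first.
      by have := le_a j; rewrite mnmDE mulmnE mnm1E neq_ij addn0.
    by apply: leq_trans a_i; case: (i \in F); case: (i \in G).
  (* Now [a] is the indicator vector of [U], so [has_two_edges a] and decomposability of [U] are the
     same inequality. *)
  have aE i : a i = (i \in U) by rewrite inE; case: (a i) (a_le1 i) => [|[]].
  split=> [i|]; first by rewrite aE; case: (i \in U); [right|left].
  split=> [/decomposableP [F [G [HF HG le_U]]]|i].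
    by apply: a_notin; exists F, G; split=> // i; rewrite aE.
  have [t [F [G [HF HG le_a]]]] := sat_a i.
  apply/decomposableP; exists (F :\ i), (G :\ i); split.
  - by apply/imsetP; exists F.
  - by apply/imsetP; exists G.
  (* At j = i both sides vanish; elsewhere the added multiple of e_i contributes 0. *)
  move=> j; have := le_a j; rewrite mnmDE mulmnE mnm1E eq_sym !in_setD1 aE.
  by case: eqP => //= _; rewrite addn0.
have aE i : a i = (i \in U) by rewrite inE; case: (a01 i) => ->.
split.
  apply: edge_ideal_sqrX_saturation => i.
  have /decomposableP [_ [_ [/imsetP [F HF ->] /imsetP [G HG ->] le_U]]] := dec i.
  (* The lifted edges may both contain [i]; the added 2 e_i covers this. *)
  exists F, G; split=> // j; have := le_U j.
  rewrite mnmDE mulmnE mnm1E eq_sym !in_setD1 aE.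
  case: eqP => _ /=; last by rewrite addn0.
  by rewrite (leq_trans _ (leq_addl _ _)) //; case: (j \in F); case: (j \in G).
move/mem_edge_ideal_sqrX => [F [G [HF HG le_a]]].
apply/indec/decomposableP.
by exists F, G; split=> // i; rewrite -aE.
Qed.
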